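(* Let $n\geq3$, let $\mathbf{M}=(M_1,M_2)\in\mathcal{M}^{1,n-1}_n$ be a plurimatroid, let $\mathcal{B}_1,\mathcal{B}_2$ be the sets of bases of $M_1,M_2$, and put $K_1=\{k\in[n]:\{k\}\in\mathcal{B}_1\}$ and $K_2=\{k\in[n]:[n]\setminus\{k\}\in\mathcal{B}_2\}$. Let $\mathbb{F}_{\mathbf{M}}$ be the associated thin Schubert cell in $\mathbb{F}_{1<n-1}(\mathbb{C}^n)$. Then: (1) If $|K_1\cap K_2|=0$, then $\dim\mathbb{F}_{\mathbf{M}}=\dim(G_{M_1}\times G_{M_2})=|K_1|+|K_2|-2$. (2) If $|K_1\cap K_2|\geq2$, then $\dim\mathbb{F}_{\mathbf{M}}=\dim(G_{M_1}\times G_{M_2})-1=|K_1|+|K_2|-3$.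
   Context: $[n]=\{1,\dots,n\}$ and $\binom{[n]}{d}$ is the set of $d$-element subsets of $[n]$. A matroid of rank $d$ on $n$ elements is a pair $M=([n],\mathcal{B})$ with $\emptyset\neq\mathcal{B}\subset\binom{[n]}{d}$ such that for all $I,J\in\mathcal{B}$ and $i\in I\setminus J$ there is $j\in J\setminus I$ with $(I\setminus\{i\})\cup\{j\}\in\mathcal{B}$; the elements of $\mathcal{B}$ are its bases. $\mathcal{M}^d_n$ is the set of such matroids and $\mathcal{M}^{1,n-1}_n=\mathcal{M}^1_n\times\mathcal{M}^{n-1}_n$; its elements are called plurimatroids. $G(d,n)$ is the Grassmannian of $d$-dimensional subspaces of $\mathbb{C}^n$ with Plücker coordinates $(p_I)$; for $M=([n],\mathcal{B})\in\mathcal{M}^d_n$, $G_M=\{W\in G(d,n):p_I(W)\neq0\Leftrightarrow I\in\mathcal{B}\}$. $\mathbb{F}_{1<n-1}(\mathbb{C}^n)=\{(W_1,W_2)\in G(1,n)\times G(n-1,n):W_1\subset W_2\}$ and $\mathbb{F}_{\mathbf{M}}=(G_{M_1}\times G_{M_2})\cap\mathbb{F}_{1<n-1}(\mathbb{C}^n)$. *)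

(* Defs.v *)
From HB Require Import structures.
From mathcomp Require Import all_boot all_order all_algebra.
From mathcomp Require Import complex mpoly.
From mathcomp Require Import boolp classical_sets reals constructive_ereal ereal.
From mathcomp Require Import topology.

Set Implicit Arguments.
Unset Strict Implicit.
Unset Printing Implicit Defensive.
Import Order.TTheory GRing.Theory Num.Theory.
Local Open Scope classical_set_scope.
Local Open Scope ring_scope.

(* The ground set [n] is 'I_n; bases are kept as plain subsets of 'I_n so that
   the exchange axiom reads as usual. *)
Record matroid (d n : nat) := Matroid {
  bases : {set {set 'I_n}};
  bases_neq0 : bases != finset.set0;
  bases_card : forall I, I \in bases -> #|I| = d;
  bases_exchange : forall I J, I \in bases -> J \in bases ->
    forall i, i \in I :\: J ->
    exists2 j, j \in J :\: I & (j |: (I :\ i))%SET \in bases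
}.

Definition plurimatroid (d1 d2 n : nat) : Type := (matroid d1 n * matroid d2 n)%type.

Definition dsubset (d n : nat) := {I : {set 'I_n} | #|I| == d}.
HB.instance Definition _ d n := Finite.on (dsubset d n).

Definition dsubset_nth d n (I : dsubset d n) (j : 'I_d) : 'I_n :=
  enum_val (cast_ord (esym (eqP (valP I))) j).

Definition grassmannian (K : fieldType) (d n : nat) :=
  {W : {vspace 'rV[K]_n} | \dim W == d}.
HB.instance Definition _ K d n := Choice.on (grassmannian K d n).

(* Pluecker coordinates: maximal minors of the matrix whose rows are the basis
   of W chosen by the library. Another basis rescales all of them by the same
   nonzero scalar, which affects neither their vanishing nor the vanishing of
   homogeneous polynomials in them. *)
Definition plucker K d n (W : grassmannian K d n) (I : dsubset d n) : K :=
  \det (\matrix_(i < d, j < d) (vbasis (val W))`_i ord0 (dsubset_nth I j)).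

Definition schubert_cell K d n (M : matroid d n) : set (grassmannian K d n) :=
  [set W | forall I : dsubset d n, plucker W I != 0 <-> val I \in bases M].

(* A separate name for G(d1, n) x G(d2, n), so that it can carry the Zariski
   topology, which is not the product of the Zariski topologies. *)
Definition grass_prod (K : fieldType) (d1 d2 n : nat) : Type :=
  (grassmannian K d1 n * grassmannian K d2 n)%type.
HB.instance Definition _ K d1 d2 n := Choice.on (grass_prod K d1 d2 n).

Section Zariski.
Variables (K : fieldType) (d1 d2 n : nat).
Local Notation N1 := #|{: dsubset d1 n}|.
Local Notation N2 := #|{: dsubset d2 n}|.
Local Notation X := (grass_prod K d1 d2 n).

Definition bihomogeneous (f : {mpoly K[N1 + N2]}) : Prop :=
  exists a b : nat, forall m, m \in msupp f ->
    (\sum_(i < N1) m (lshift N2 i) = a)%N /\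
    (\sum_(j < N2) m (rshift N1 j) = b)%N.

Definition biplucker (W : X) (k : 'I_(N1 + N2)) : K :=
  match split k with
  | inl i => plucker W.1 (enum_val i)
  | inr j => plucker W.2 (enum_val j)
  end.

Definition zero_locus (S : set {mpoly K[N1 + N2]}) : set X :=
  [set W | forall f, S f -> f.@[biplucker W] = 0].

Definition zariski_closed (A : set X) : Prop :=
  exists2 S, S `<=` bihomogeneous & A = zero_locus S.

Definition zariski_open (U : set X) : Prop := zariski_closed (~` U).

Lemma bihomogeneousM f g :
  bihomogeneous f -> bihomogeneous g -> bihomogeneous (f * g).
Proof.
move=> [a [b hf]] [a' [b' hg]]; exists (a + a')%N, (b + b')%N => m.
move=> /msuppM_le/allpairsP[[m1 m2] /= [/hf[<- <-] /hg[<- <-] ->]].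
by split; rewrite -big_split; apply: eq_bigr => i _; rewrite mnmDE.
Qed.

Lemma zariski_openT : zariski_open setT.
Proof.
rewrite /zariski_open setCT; exists [set 1].
  move=> _ ->; exists 0%N, 0%N => m; rewrite msupp1 inE => /eqP ->.
  by split; apply: big1 => i _; rewrite mnm0E.
apply/seteqP; split=> // W /(_ 1 erefl)/eqP.
by rewrite meval1 oner_eq0.
Qed.

Lemma zariski_openI : setI_closed zariski_open.
Proof.
move=> U V [S hS US] [S' hS' VS']; rewrite /zariski_open setCI US VS'.
exists [set f * g | f in S & g in S'].
  by move=> _ [f Sf [g Sg <-]]; apply: bihomogeneousM; [apply: hS|apply: hS'].
apply/seteqP; split=> W.
  move=> SW _ [f Sf [g Sg <-]]; rewrite mevalM.
  case: SW => h; [rewrite (h f Sf) mul0r|rewrite (h g Sg) mulr0] => //.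
move=> h; case: (pselect (zero_locus S W)) => [|nSW]; [by left|right=> g Sg].
apply/eqP; apply: contra_notT nSW => gW f Sf.
have /eqP : (f * g).@[biplucker W] = 0 by apply: h; exists f => //; exists g.
by rewrite mevalM mulf_eq0 (negbTE gW) orbF => /eqP.
Qed.

Lemma zariski_open_bigU (I : Type) (U : I -> set X) :
  (forall i, zariski_open (U i)) -> zariski_open (\bigcup_i U i).
Proof.
move=> hU; exists [set f | exists S i,
    [/\ S `<=` bihomogeneous, ~` U i = zero_locus S & S f]].
  by move=> f [S [i [hS _ Sf]]]; apply: hS.
rewrite setC_bigcup; apply/seteqP; split=> W h.
  by move=> f [S [i [_ US Sf]]]; have := h i Logic.I; rewrite US => /(_ f Sf).
move=> i _; have [S hS US] := hU i; rewrite US => f Sf.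
by apply: h; exists S, i.
Qed.

HB.instance Definition _ := isOpenTopological.Build X
  zariski_openT zariski_openI zariski_open_bigU.

End Zariski.

Definition flag_variety K d1 d2 n : set (grass_prod K d1 d2 n) :=
  [set W | (val W.1 <= val W.2)%VS].

Definition schubert_cell_prod K d1 d2 n (M : plurimatroid d1 d2 n) :
    set (grass_prod K d1 d2 n) :=
  schubert_cell M.1 `*` schubert_cell M.2.

Definition thin_schubert_cell K d1 d2 n (M : plurimatroid d1 d2 n) :
    set (grass_prod K d1 d2 n) :=
  schubert_cell_prod M `&` @flag_variety K d1 d2 n.

Section KrullDimension.
Variable T : topologicalType.

Definition irreducible (Z : set T) : Prop :=
  Z !=set0 /\ forall A B, closed A -> closed B ->
    Z `<=` A `|` B -> Z `<=` A \/ Z `<=` B.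

Definition irreducible_closed_in (X Z : set T) : Prop :=
  irreducible Z /\ exists2 A, closed A & Z = X `&` A.

Definition irreducible_chain (X : set T) (k : nat) (Z : nat -> set T) : Prop :=
  (forall i, (i <= k)%N -> irreducible_closed_in X (Z i)) /\
  (forall i, (i < k)%N -> Z i `<` Z i.+1).

(* Krull dimension of X in the subspace topology; it is -oo when X is empty. *)
Definition krull_dim (R : realType) (X : set T) : \bar R :=
  ereal_sup [set k%:R%:E | k in [set k | exists Z, irreducible_chain X k Z]].

End KrullDimension.

(* Main.v *)
(* A pair (line, hyperplane) is given by a vector v and a covector w, each up to
   scaling, with v_k and w_k the Pluecker coordinates up to sign, and the line
   lies in the hyperplane iff sum_k v_k w_k = 0. The product of the two cells is
   thus a product of tori of dimensions |K1| - 1 and |K2| - 1. If K1 and K2 are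
   disjoint, incidence is automatic; if they share i1 and i2, normalising
   v_{i1} = w_{i2} = 1 and solving the incidence relation for v_{i2}
   identifies the thin cell with a nonempty principal open subset of an affine
   space of dimension |K1| + |K2| - 3.

   It remains to see that a nonempty principal open subset of K^m has Krull
   dimension m. Coordinate subspaces give a chain of length m. Conversely, given
   a chain Z_0 < ... < Z_k of irreducible closed sets, choose f_i vanishing on
   Z_{i-1} but not on Z_i; then f_1, ..., f_k are algebraically independent on
   Z_k, whence k <= m by counting monomials of bounded degree. *)
Require Import Defs.
From HB Require Import structures.
From mathcomp Require Import all_boot all_order all_algebra.
From mathcomp Require Import complex mpoly zify ring.
From mathcomp Require Import boolp classical_sets reals constructive_ereal ereal.
From mathcomp Require Import topology.
Set Implicit Arguments.
Unset Strict Implicit.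
Unset Printing Implicit Defensive.
Import Order.TTheory GRing.Theory Num.Theory.
Local Open Scope classical_set_scope.
Local Open Scope ring_scope.

(** * Algebraic independence along a chain *)

Section AlgebraicDependence.
Variable K : fieldType.

Lemma card_bmultinom_le m b : (#|{: 'X_{1..m < b}}| <= b ^ m)%N.
Proof.
have le_mdeg (x : 'X_{1..m}) i : (x i <= mdeg x)%N.
  by rewrite mdegE (bigD1 i)//= leq_addr.
pose f (x : 'X_{1..m < b}) : {ffun 'I_m -> 'I_b} :=
  [ffun i => Ordinal (leq_ltn_trans (le_mdeg (bmnm x) i) (bmdeg x))].
have f_inj : injective f.
  move=> x y /ffunP xy; apply/val_inj/mnmP => i /=.
  by have /(congr1 val) := xy i; rewrite !ffunE.
by apply: leq_trans (leq_card f f_inj) _; rewrite card_ffun !card_ord.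
Qed.

(* Below degree N in each variable there are N^k monomials in the f_i, all of
   degree O(N), while only O(N^m) monomials in m variables are available. *)
Lemma mpoly_alg_dependent m k (f : k.-tuple {mpoly K[m]}) :
  (m < k)%N -> exists2 F : {mpoly K[k]}, F != 0 & F \mPo f = 0.
Proof.
move=> mk.
(* The constants are chosen so that b^m < N^k: since b <= c N, one gets b^m <= c^m N^m < N^(m+1) <=
   N^k. *)
pose d := \max_(i < k) msize (tnth f i).
pose c := (k * d).+1.
pose N := (c ^ m).+1.
pose b := (k * d * N).+1.
pose mon (a : {ffun 'I_k -> 'I_N}) : 'X_{1..k} := [multinom (a i : nat) | i < k].
pose g a := 'X_[mon a] \mPo f.
have sz_g a : (msize (g a) <= b)%N.
  have szX p e : (msize (p ^+ e : {mpoly K[m]}) <= (e * msize p).+1)%N.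
    have [->|p0] := eqVneq p 0.
      by case: e => [|e]; rewrite ?expr0 ?msize1// expr0n/= msize0.
    elim: e => [|e IH]; first by rewrite expr0 msize1.
    rewrite exprS msizeM ?expf_neq0//.
    apply: leq_trans (leq_pred _) _; rewrite mulSn -addnS leq_add2l//.
  rewrite /g comp_mpolyX.
  have : (msize (\prod_(i < k) tnth f i ^+ mon a i) <=
      (\sum_(i < k) (mon a i * d)).+1)%N.
    elim/big_ind2: _ => [|x p y q hp hq|i _]; first by rewrite msize1.
      have [->|p0] := eqVneq p 0; first by rewrite mul0r msize0.
      have [->|q0] := eqVneq q 0; first by rewrite mulr0 msize0.
      rewrite msizeM// -ltnS prednK; last first.
        by rewrite addn_gt0 lt0n msize_poly_eq0 p0.
      by rewrite -addnS -addSn leq_add.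
    apply: leq_trans (szX _ _) _; rewrite ltnS leq_mul2l.
    by rewrite (leq_bigmax i) orbT.
  move=> /leq_trans; apply; rewrite ltnS.
  apply: (@leq_trans (\sum_(i < k) N * d)%N).
    apply: leq_sum => i _; rewrite leq_mul2r mnmE ltnW ?orbT//.
  by rewrite sum_nat_const card_ord mulnCA mulnC.
(* Rows are the products [g a], columns the monomials of degree below b. Rows outnumber columns, so
   a nonzero vector of the left kernel supplies the coefficients of F. *)
pose A : 'M[K]_(#|{: {ffun 'I_k -> 'I_N}}|, #|{: 'X_{1..m < b}}|) :=
  \matrix_(i, j) (g (enum_val i))@_(bmnm (enum_val j)).
have ker0 : kermx A != 0.
  rewrite kermx_eq0 /row_free; apply: contraTneq (rank_leq_col A) => ->.
  rewrite -ltnNge; apply: leq_ltn_trans (card_bmultinom_le m b) _.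
  rewrite card_ffun !card_ord.
  apply: (@leq_trans (N ^ m.+1)); last by rewrite leq_pexp2l.
  apply: (@leq_ltn_trans ((c * N) ^ m)).
    case: (m) => // m'; rewrite leq_exp2r// /b /c mulSn addnC -addn1 leq_add2l//.
  by rewrite expnMn expnSr mulnC ltn_pmul2l// expn_gt0.
have /rowV0Pn[v] := ker0; rewrite sub_kermx => /eqP vA v_neq0.
pose u a := v 0 (enum_rank a).
pose F : {mpoly K[k]} := \sum_a u a *: 'X_[mon a].
have monI : injective mon.
  move=> a a' /mnmP e; apply/ffunP => x; apply/val_inj.
  by have := e x; rewrite !mnmE.
have FE a : F@_(mon a) = u a.
  rewrite /F raddf_sum /= (bigD1 a)//= mcoeffZ mcoeffX eqxx mulr1.
  rewrite big1 ?addr0// => a' /negPf aa'.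
  by rewrite mcoeffZ mcoeffX (inj_eq monI) aa' mulr0.
exists F.
  apply: contraNneq v_neq0 => F0; apply/eqP/rowP => x; rewrite mxE.
  by rewrite -(enum_valK x) -[LHS]FE F0 mcoeff0.
have FfE : F \mPo f = \sum_a u a *: g a.
  by rewrite /F raddf_sum /=; apply: eq_bigr => a _; rewrite comp_mpolyZ.
apply/mpolyP => mm; rewrite mcoeff0 FfE raddf_sum /=.
have [mmb|bmm] := ltnP (mdeg mm) b.
  move/rowP/(_ (enum_rank (BMultinom mmb))): vA; rewrite mxE mxE => e; rewrite -[RHS]e.
  rewrite (reindex (@enum_val {ffun 'I_k -> 'I_N} predT)) /=; last first.
    by apply: onW_bij; exact: enum_val_bij.
  by apply: eq_bigr => x _; rewrite mcoeffZ mxE enum_rankK /u enum_valK.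
rewrite big1// => a _; rewrite mcoeffZ memN_msupp_eq0 ?mulr0//.
by apply: msize_mdeg_ge; apply: leq_trans (sz_g a) bmm.
Qed.

(** Monomials free of the last variable go into G; every other monomial is divisible by it and goes,
    after division, into H. *)
Lemma mpoly_split_last k (F : {mpoly K[k.+1]}) :
  exists (G : {mpoly K[k]}) (H : {mpoly K[k.+1]}),
    F = G \mPo [tuple 'X_(widen_ord (leqnSn k) i) | i < k] + 'X_ord_max * H.
Proof.
elim/mpolyind: F => [|c m F _ _ [G [H ->]]].
  by exists 0, 0; rewrite comp_mpoly0 mulr0 addr0.
have [m0|m0] := eqVneq (m ord_max) 0%N.
  exists (c *: 'X_[[multinom m (widen_ord (leqnSn k) i) | i < k]] + G), H.
  rewrite comp_mpolyD addrA; congr (_ + _ + _).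
  rewrite comp_mpolyZ; congr (_ *: _); rewrite comp_mpolyX mpolyXE_id.
  rewrite big_ord_recr /= m0 expr0 mulr1; apply: eq_bigr => i _.
  by rewrite tnth_mktuple mnmE.
exists G, (c *: 'X_[(m - U_(ord_max))%MM] + H).
rewrite mulrDr addrCA; congr (_ + (_ + _)).
rewrite -scalerAr -mpolyXD addmC submK//.
by apply/mnm_lepP => i; rewrite mnm1E; case: eqVneq => // <-; rewrite lt0n.
Qed.

(* Split a relation F as G + X_k H with G free of the last variable X_k: on
   Z_{k-1} only G survives, and is zero by induction; on Z_k the factor f_k can
   then be cancelled by irreducibility. *)
Lemma chain_alg_independent m (Y : nat -> set ('I_m -> K))
    (f : nat -> {mpoly K[m]}) k :
  Y 0%N !=set0 ->
  (forall i, (i < k)%N -> Y i `<=` Y i.+1) ->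
  (forall i, (i < k)%N -> forall p q : {mpoly K[m]},
    (forall t, Y i.+1 t -> (p * q).@[t] = 0) ->
    (forall t, Y i.+1 t -> p.@[t] = 0) \/ (forall t, Y i.+1 t -> q.@[t] = 0)) ->
  (forall i, (i < k)%N -> forall t, Y i t -> (f i).@[t] = 0) ->
  (forall i, (i < k)%N -> exists2 t, Y i.+1 t & (f i).@[t] != 0) ->
  forall F : {mpoly K[k]},
    (forall t, Y k t -> F.@[fun i => (f i).@[t]] = 0) -> F = 0.
Proof.
move=> [t0 Y0]; elim: k => [|k IH] sub prime vanish nvanish F.
  have -> : F = (F@_0)%:MP.
    apply/mpolyP => u; have -> : u = 0%MM by apply/mnmP; case.
    by rewrite mcoeffC eqxx mulr1.
  by move=> /(_ t0 Y0); rewrite mevalC => ->; rewrite mpolyC0.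
have {}IH : forall G : {mpoly K[k]},
    (forall t, Y k t -> G.@[fun i => (f i).@[t]] = 0) -> G = 0.
  apply: IH => i ik; [exact: sub (ltnW _)|exact: prime (ltnW _)|
                      exact: vanish (ltnW _)|exact: nvanish (ltnW _)].
(* Once G = 0, the relation is F = X_k H with H of smaller size than F, so an inner induction on
   [msize F] disposes of H. *)
have [n] := ubnP (msize F); elim: n F => // n IHn F; rewrite ltnS => szF F0.
have [G [H FE]] := mpoly_split_last F.
have evF t : F.@[fun i => (f i).@[t]] =
    G.@[fun i => (f i).@[t]] + (f k).@[t] * H.@[fun i => (f i).@[t]].
  rewrite [in LHS]FE mevalD mevalM mevalXU comp_mpoly_meval; congr (_ + _).
  by apply: meval_eq => i; rewrite tnth_mktuple mevalXU.
have G0 : G = 0.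
  apply: IH => t Yt; have := F0 t (sub k (leqnn _) _ Yt).
  by rewrite evF (vanish k) // mul0r addr0.
rewrite G0 comp_mpoly0 add0r in FE.
have [H0|Hn0] := eqVneq H 0; first by rewrite FE H0 mulr0.
rewrite FE (_ : H = 0) ?mulr0//; apply: IHn.
  apply: leq_trans szF; rewrite FE msizeM// ?msizeX ?mdeg1//.
  by apply/negP => /eqP/(congr1 (fun p => msize p)); rewrite msizeX mdeg1 msize0.
pose HF := H \mPo [tuple f i | i < k.+1].
have HFE t : HF.@[t] = H.@[fun i => (f i).@[t]].
  by rewrite comp_mpoly_meval; apply: meval_eq => i; rewrite tnth_mktuple.
have fkHF t : Y k.+1 t -> (f k * HF).@[t] = 0.
  by move=> Yt; have := F0 t Yt; rewrite evF G0 meval0 add0r mevalM HFE.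
have [fk0|HF0] := prime k (leqnn _) _ _ fkHF.
  by have [t /fk0 -> /eqP] := nvanish k (leqnn _).
by move=> t /HF0; rewrite HFE.
Qed.

End AlgebraicDependence.

(** * Krull dimension in an affine chart *)

Section AffineChart.
Variable K : numFieldType.

(** In characteristic zero the first [size p] naturals are distinct, hence too many to be all roots
    of p. *)
Lemma poly_non_root (p : {poly K}) : p != 0 -> exists s, p.[s] != 0.
Proof.
move=> p0; apply/not_existsP => h.
have := @max_poly_roots K p [seq i%:R | i <- iota 0 (size p)] p0.
rewrite size_map size_iota ltnn map_inj_uniq ?iota_uniq; last first.
  by move=> i j /eqP; rewrite eqr_nat => /eqP.
move=> impossible; suff : false by []; apply: impossible => //.
by apply/allP => s _; rewrite rootE; apply/negP => /negP /h.
Qed.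

Lemma meval_line m (f : {mpoly K[m]}) (t u : 'I_m -> K) :
  exists p : {poly K}, forall s, p.[s] = f.@[fun j => t j + s * u j].
Proof.
exists (mmap polyC (fun j => (t j)%:P + 'X * (u j)%:P) f) => s.
rewrite mevalE /mmap horner_sum; apply: eq_bigr => mm _.
rewrite hornerM hornerC /mmap1 horner_prod; congr (_ * _).
by apply: eq_bigr => j _; rewrite horner_exp hornerD hornerM !hornerC hornerX.
Qed.

(** The hypotheses make psi a map of X onto the principal open set g != 0, under which the closed
    subsets of X correspond to common zero sets of polynomials. *)
Variables (R : realType) (T : topologicalType) (X : set T) (m : nat).
Variables (psi : T -> 'I_m -> K) (g : {mpoly K[m]}) (t0 : 'I_m -> K).
Hypothesis g_psi : forall W, X W -> g.@[psi W] != 0.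
Hypothesis psi_onto : forall t, g.@[t] != 0 -> exists2 W, X W & psi W =1 t.
Hypothesis g_t0 : g.@[t0] != 0.
Hypothesis closed_mpoly : forall f : {mpoly K[m]},
  exists2 A : set T, closed A & forall W, X W -> (A W <-> f.@[psi W] = 0).
Hypothesis mpoly_closed : forall A : set T, closed A ->
  exists S : set {mpoly K[m]},
    forall W, X W -> (A W <-> forall f, S f -> f.@[psi W] = 0).

Lemma closed_separation (A : set T) (W : T) : closed A -> X W -> ~ A W ->
  exists2 f : {mpoly K[m]}, f.@[psi W] != 0 &
    forall W', X W' -> A W' -> f.@[psi W'] = 0.
Proof.
move=> /mpoly_closed[S AS] XW /(iffLR (not_iff_compat (AS W XW))).
move=> /existsNP[f /not_implyP[Sf /eqP fW]].
by exists f => // W' XW' /(AS W' XW'); exact.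
Qed.

Lemma irreducible_chain_le k Z : irreducible_chain X k Z -> (k <= m)%N.
Proof.
move=> [irrZ ltZ]; rewrite leqNgt; apply/negP => mk.
have ZX i W : (i <= k)%N -> Z i W -> X W.
  by move=> ik; have [_ [A _ ->]] := irrZ i ik => -[].
(* [choice] wants a polynomial for every natural i, so the bound i < k sits under the existential
   and 0 serves beyond it. *)
have sepZ i : exists f : {mpoly K[m]}, (i < k)%N ->
    (forall W, Z i W -> f.@[psi W] = 0) /\
    exists2 W, Z i.+1 W & f.@[psi W] != 0.
  have [ik|] := boolP (i < k)%N; last by exists 0.
  have [_ /existsNP[W /not_implyP[ZW nZW]]] := ltZ i ik.
  have [_ [A cA ZA]] := irrZ i (ltnW ik).
  have XW := ZX _ _ ik ZW.
  have nAW : ~ A W by move=> AW; apply: nZW; rewrite ZA.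
  have [f fW fA] := closed_separation cA XW nAW.
  by exists f => _; split; [rewrite ZA => W' [XW' AW']; exact: fA|exists W].
have [f fP] := choice sepZ.
have [F F0 Ff] := mpoly_alg_dependent [tuple f i | i < k] mk.
move/eqP: F0; apply.
apply: (@chain_alg_independent _ _ (fun i => psi @` Z i) f k).
- have [[[W ZW] _] _] := irrZ 0%N (leq0n _).
  by exists (psi W), W.
- by move=> i ik t [W ZW <-]; exists W => //; apply: (ltZ i ik).1.
(* Irreducibility of Z_{i+1} becomes primality of the ideal vanishing on its image: the closed sets
   p = 0 and q = 0 cover it. *)
- move=> i ik p q pq0.
  have [A cA AP] := closed_mpoly p; have [B cB BP] := closed_mpoly q.
  have [[_ /(_ A B cA cB) irr] _] := irrZ i.+1 ik.
  case: irr => [W ZW|ZA|ZB].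
  + have XW := ZX _ _ ik ZW.
    have /eqP := pq0 _ (ex_intro2 _ _ W ZW erefl).
    rewrite mevalM mulf_eq0 => /orP[/eqP|/eqP] e.
      by left; apply/AP.
    by right; apply/BP.
  + by left => t [W ZW <-]; apply/AP; [exact: ZX ZW|exact: ZA].
  + by right => t [W ZW <-]; apply/BP; [exact: ZX ZW|exact: ZB].
- by move=> i ik t [W ZW <-]; apply: (fP i ik).1.
- by move=> i ik; have [_ [W ZW fW]] := fP i ik; exists (psi W) => //; exists W.
- move=> t _; have := congr1 (meval t) Ff.
  rewrite comp_mpoly_meval meval0 => e; rewrite -[RHS]e.
  by apply: meval_eq => i; rewrite tnth_mktuple.
Qed.

(** The coordinate subspaces are taken through t0 because g may vanish at the origin. They grow from
    the fibre over t0 at i = 0 to X at i = m. *)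
Let slice (i : nat) : set T :=
  X `&` [set W | forall j : 'I_m, (i <= j)%N -> psi W j = t0 j].

Let irreducible_slice i : irreducible_closed_in X (slice i).
Proof.
split; last first.
  have hyp j : exists A : set T, closed A /\
      forall W, X W -> (A W <-> ('X_j - (t0 j)%:MP).@[psi W] = 0).
    by have [A] := closed_mpoly ('X_j - (t0 j)%:MP); exists A.
  have [A AP] := choice hyp.
  exists (\bigcap_(j in [set j : 'I_m | (i <= j)%N]) A j).
    by apply: closed_bigI => j _; exact: (AP j).1.
  have AE W j : X W -> A j W <-> psi W j = t0 j.
    move=> XW; rewrite (AP j).2// mevalB mevalXU mevalC.
    by split=> [/eqP|->]; rewrite ?subrr// subr_eq0 => /eqP.
  by apply/seteqP; split=> W [XW h]; split=> // j ij; apply/AE => //; exact: h.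
split.
  by have [W XW psiW] := psi_onto g_t0; exists W; split=> // j _; rewrite psiW.
move=> A B cA cB sAB; apply: contrapT => /not_orP[].
move=> /existsNP[W1 /not_implyP[[XW1 sW1] nA]].
move=> /existsNP[W2 /not_implyP[[XW2 sW2] nB]].
have [f1 f1W f1A] := closed_separation cA XW1 nA.
have [f2 f2W f2B] := closed_separation cB XW2 nB.
(* Irreducibility is tested on the line through the two witnesses. *)
pose l s j := psi W1 j + s * (psi W2 j - psi W1 j).
have l0 : l 0 =1 psi W1 by move=> j; rewrite /l mul0r addr0.
have l1 : l 1 =1 psi W2 by move=> j; rewrite /l mul1r addrC subrK.
have [p1 p1E] := meval_line f1 (psi W1) (fun j => psi W2 j - psi W1 j).
have [p2 p2E] := meval_line f2 (psi W1) (fun j => psi W2 j - psi W1 j).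
have [pg pgE] := meval_line g (psi W1) (fun j => psi W2 j - psi W1 j).
have nz (p : {poly K}) s : p.[s] != 0 -> p != 0.
  by apply: contraNneq => ->; rewrite horner0.
(* f1 is nonzero at s = 0, f2 at s = 1 and g at s = 0, so the product is a nonzero polynomial; a
   non-root s yields a point of the slice outside A and B. *)
have [s] : exists s, (p1 * p2 * pg).[s] != 0.
  apply: poly_non_root; rewrite !mulf_neq0//.
  - by apply: (nz _ 0); rewrite p1E (meval_eq _ l0).
  - by apply: (nz _ 1); rewrite p2E (meval_eq _ l1).
  - by apply: (nz _ 0); rewrite pgE (meval_eq _ l0) g_psi.
rewrite !hornerM !mulf_eq0 !negb_or p1E p2E pgE => /andP[/andP[f1s f2s] gs].
have [W XW psiW] := psi_onto gs.
have : slice i W.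
  by split=> // j ij; rewrite psiW sW1// sW2// subrr mulr0 addr0.
move=> /sAB[AW|BW].
- by move: f1s; rewrite -(meval_eq _ psiW) f1A// eqxx.
- by move: f2s; rewrite -(meval_eq _ psiW) f2B// eqxx.
Qed.

Let slice_chain : irreducible_chain X m slice.
Proof.
split=> [i _|i im]; first exact: irreducible_slice.
split=> [W [XW sW]|]; first by split=> // j /ltnW; exact: sW.
pose i' := Ordinal im.
have [p pE] := meval_line g t0 (fun j => (j == i')%:R).
(* The factor 'X forces s != 0, so the i-th coordinate really moves away from that of t0 and the
   inclusion is strict. *)
have [s] : exists s, (p * 'X).[s] != 0.
  apply: poly_non_root; rewrite mulf_neq0 ?polyX_eq0//.
  apply: contraTneq g_t0 => p0; rewrite negbK; have := pE 0.
  rewrite p0 horner0 => {1}->; apply/eqP; apply: meval_eq => j.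
  by rewrite mul0r addr0.
rewrite hornerM hornerX mulf_eq0 negb_or pE => /andP[gs s0].
have [W XW psiW] := psi_onto gs.
move=> /(_ W)[].
  split=> // j ij; rewrite psiW (_ : j == i' = false) ?mulr0 ?addr0//.
  by apply/negbTE; rewrite -val_eqE/= neq_ltn ij orbT.
move=> _ /(_ i' (leqnn _))/eqP.
by rewrite psiW eqxx mulr1 -subr_eq0 addrAC subrr add0r (negbTE s0).
Qed.

Lemma krull_dim_affine_chart : krull_dim R X = m%:R%:E.
Proof.
apply/eqP; rewrite eq_le; apply/andP; split.
  apply: ub_ereal_sup => _ [k [Z chainZ] <-].
  by rewrite lee_fin ler_nat (irreducible_chain_le chainZ).
by apply: ereal_sup_ubound; exists m => //; exists slice.
Qed.

End AffineChart.

(** * Lines and hyperplanes *)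

Section LinesAndHyperplanes.
Variables (K : fieldType) (n : nat).

Definition dsubset1 (k : 'I_n.+1) : dsubset 1 n.+1 :=
  exist _ [set k]%SET (introT eqP (cards1 k)).

Lemma card_setC1_ord (k : 'I_n.+1) : #|[set~ k]%SET| == n.
Proof. by rewrite cardsC1 card_ord. Qed.

Definition dsubsetC1 (k : 'I_n.+1) : dsubset n n.+1 :=
  exist _ [set~ k]%SET (card_setC1_ord k).

Lemma dsubset1P (I : dsubset 1 n.+1) : exists k, I = dsubset1 k.
Proof.
case: I => I cI; have /cards1P[k Ik] := cI.
by exists k; apply/val_inj.
Qed.

Lemma dsubsetC1P (I : dsubset n n.+1) : exists k, I = dsubsetC1 k.
Proof.
case: I => I cI; have : #|~: I|%SET == 1%N.
  by rewrite cardsCs finset.setCK card_ord (eqP cI) subSnn.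
by move=> /cards1P[k Ik]; exists k; apply/val_inj; rewrite /= -Ik finset.setCK.
Qed.

Lemma dsubset_nth1 k (j : 'I_1) : dsubset_nth (dsubset1 k) j = k.
Proof.
have := enum_valP (cast_ord (esym (eqP (valP (dsubset1 k)))) j).
by rewrite inE => /eqP.
Qed.

(** Both lists are strictly increasing with the same members. This identifies column j of the minor
    omitting k with column [lift k j], as in a cofactor. *)
Lemma enum_setC1 (k : 'I_n.+1) :
  enum [set~ k]%SET = [seq lift k j | j <- enum 'I_n].
Proof.
have ltn_sorted p (s : seq 'I_p) : subseq s (enum 'I_p) ->
    sorted ltn [seq val i | i <- s].
  move=> /(map_subseq val); rewrite val_enum_ord => /subseq_sorted; apply.
    exact: ltn_trans.
  exact: iota_ltn_sorted.
apply: (inj_map val_inj).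
apply: (irr_sorted_eq ltn_trans ltnn).
- by apply: ltn_sorted; rewrite [enum (ordinal _)]enumT; apply: filter_subseq.
- have := ltn_sorted _ _ (subseq_refl (enum 'I_n)).
  rewrite -map_comp !sorted_map; apply: sub_sorted => i j /= ij.
  by rewrite /bump; lia.
- move=> x; apply/mapP/mapP => -[y].
    rewrite mem_enum !inE eq_sym => /unlift_some[j -> _] ->.
    by exists (lift k j) => //; rewrite map_f ?mem_enum.
  by move=> /mapP[j _ ->] ->; exists (lift k j); rewrite // mem_enum !inE eq_sym neq_lift.
Qed.

Lemma dsubset_nthC1 k (j : 'I_n) : dsubset_nth (dsubsetC1 k) j = lift k j.
Proof.
rewrite /dsubset_nth (enum_val_nth k) /= enum_setC1 (nth_map j) ?size_enum_ord//.
by rewrite nth_ord_enum.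
Qed.

Definition line_coord (W : grassmannian K 1 n.+1) (k : 'I_n.+1) : K :=
  plucker W (dsubset1 k).

(* Up to sign these are the maximal minors, so that W is the orthogonal of
   this vector by Laplace expansion along an additional row. *)
Definition normal_coord (W : grassmannian K n n.+1) (k : 'I_n.+1) : K :=
  (-1) ^+ k * plucker W (dsubsetC1 k).

Lemma line_coordE W k : line_coord W k = (vbasis (val W))`_0 0 k.
Proof. by rewrite /line_coord /plucker det_mx11 mxE dsubset_nth1. Qed.

Lemma line_span (W : grassmannian K 1 n.+1) : val W = <[\row_k line_coord W k]>%VS.
Proof.
have -> : \row_k line_coord W k = (vbasis (val W))`_0.
  by apply/rowP => k; rewrite mxE line_coordE.
have sz : size (vbasis (val W)) = 1%N by rewrite size_tuple (eqP (valP W)).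
have := span_basis (vbasisP (val W)).
by case: (tval _) sz => [|x []]//= _ <-; rewrite span_seq1.
Qed.

(** The scalar c compares v with the basis vector that [vbasis] selects for the line. *)
Lemma line_exists (v : 'I_n.+1 -> K) i : v i != 0 ->
  exists W, exists2 c, c != 0 & forall k, line_coord W k = c * v k.
Proof.
move=> vi; pose r := \row_k v k.
have r0 : r != 0 by apply: contraNneq vi => /rowP/(_ i); rewrite !mxE => ->.
have dimr : \dim <[r]> == 1%N by rewrite dim_vline r0.
pose W : grassmannian K 1 n.+1 := exist _ <[r]>%VS dimr.
have : \row_k line_coord W k \in <[r]>%VS.
  by rewrite -[<[r]>%VS]/(val W) line_span memv_line.
move=> /vlineP[c e]; exists W, c; last first.
  by move=> k; move/rowP/(_ k): e; rewrite !mxE.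
apply: contraNneq r0 => c0; rewrite -memv0.
by have := memv_line r; rewrite -[<[r]>%VS]/(val W) line_span e c0 scale0r.
Qed.

Lemma det_neq0_free m (X : seq 'rV[K]_m) : size X = m ->
  (\det (\matrix_(i < m, j < m) X`_i 0 j) != 0) = free X.
Proof.
move=> /eqP sX; rewrite -[X]/(tval (Tuple sX)).
set Y := Tuple sX; set A := \matrix_(_, _) _.
have uA (u : 'rV_m) : u *m A = \sum_(i < m) u 0 i *: Y`_i.
  apply/rowP => j; rewrite mxE summxE; apply: eq_bigr => i _.
  by rewrite !mxE.
apply/idP/idP => [dA|/freeP freeY].
  apply/freeP => k k0 i; apply: contraNeq dA => ki.
  apply/det0P; exists (\row_i k i).
    by apply: contraNneq ki => /rowP/(_ i); rewrite !mxE => ->.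
  by rewrite uA -[RHS]k0; apply: eq_bigr => j _; rewrite mxE.
apply/negP => /det0P[u u0]; rewrite uA => /freeY u_eq0.
by move/eqP: u0; apply; apply/rowP => i; rewrite u_eq0 mxE.
Qed.

(** x lies in W iff prepending it to the basis of W destroys freeness, i.e. makes a square
    determinant vanish; the cofactors of its first row are the normal coordinates. *)
Lemma mem_hyperplane (W : grassmannian K n n.+1) (x : 'rV_n.+1) :
  (x \in val W) = (\sum_k x 0 k * normal_coord W k == 0).
Proof.
have sz : size (vbasis (val W)) = n by rewrite size_tuple (eqP (valP W)).
have sz1 : size (x :: vbasis (val W)) = n.+1 by rewrite /= sz.
have := det_neq0_free sz1; rewrite free_cons.
have /andP[/eqP -> ->] := vbasisP (val W); rewrite andbT.
rewrite (expand_det_row _ ord0) => /(congr1 negb); rewrite !negbK => <-.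
congr (_ == 0); apply: eq_bigr => k _; rewrite mxE; congr (_ * _).
rewrite /cofactor /normal_coord add0n; congr (_ * _); congr (\det _).
by apply/matrixP => i j; rewrite !mxE dsubset_nthC1.
Qed.

(** Two vectors with the same orthogonal are proportional: the vector w_k e_i - w_i e_k is
    orthogonal to w, hence lies in W and is orthogonal to the normal coordinates too. *)
Lemma normal_coord_unique (W : grassmannian K n n.+1) (w : 'I_n.+1 -> K) i : w i != 0 ->
  (forall x : 'rV_n.+1, (x \in val W) = (\sum_k x 0 k * w k == 0)) ->
  exists2 c, c != 0 & forall k, normal_coord W k = c * w k.
Proof.
move=> wi memW.
have dot_delta (u : 'I_n.+1 -> K) j : \sum_k (delta_mx 0 j : 'rV_n.+1) 0 k * u k = u j.
  rewrite (bigD1 j)//= mxE !eqxx mul1r big1 ?addr0// => k kj.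
  by rewrite mxE (negbTE kj) mul0r.
exists (normal_coord W i / w i).
  rewrite mulf_neq0 ?invr_eq0//; apply: contraNneq wi => Wi.
  by rewrite -(dot_delta w i) -memW mem_hyperplane dot_delta Wi.
move=> k; apply/eqP; rewrite mulrAC eq_sym.
pose x : 'rV_n.+1 := w k *: delta_mx 0 i - w i *: delta_mx 0 k.
have dotx (u : 'I_n.+1 -> K) : \sum_j x 0 j * u j = w k * u i - w i * u k.
  rewrite -(dot_delta u i) -(dot_delta u k) !mulr_sumr -sumrB.
  by apply: eq_bigr => j _; rewrite !mxE mulrBl !mulrA.
have : x \in val W by rewrite memW dotx mulrC subrr.
rewrite mem_hyperplane dotx subr_eq0 => /eqP e.
by rewrite [_ * w k]mulrC e mulrAC mulfV// mul1r.
Qed.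

(** W is the kernel of the linear form with coefficients w; the form is nonzero at e_i, so
    rank-nullity gives dimension n. *)
Lemma hyperplane_exists (w : 'I_n.+1 -> K) i : w i != 0 ->
  exists W, exists2 c, c != 0 & forall k, normal_coord W k = c * w k.
Proof.
move=> wi; pose f : 'Hom('rV[K]_n.+1, 'rV[K]_1) := linfun (mulmxr (\col_k w k)).
have memf x : (x \in lker f) = (\sum_k x 0 k * w k == 0).
  rewrite memv_ker lfunE /=; apply/eqP/eqP => [/rowP/(_ 0)|e].
    by rewrite !mxE => {2}<-; apply: eq_bigr => k _; rewrite mxE.
  apply/rowP => j; rewrite !mxE -[RHS]e; apply: eq_bigr => k _.
  by rewrite mxE.
have dimf : \dim (lker f) == n.
  have := limg_ker_dim f fullv; rewrite capfv dimvf /dim /= mul1n => e.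
  suff d1 : \dim (limg f) = 1%N by move: e; rewrite d1 addn1 => -[->].
  apply/eqP; rewrite eqn_leq; apply/andP; split.
    by apply: leq_trans (dimvS (subvf _)) _; rewrite dimvf.
  rewrite lt0n dimv_eq0; apply: contraNneq wi => f0.
  have : f (delta_mx 0 i) \in limg f by rewrite memv_img ?memvf.
  rewrite f0 memv0 -memv_ker memf (bigD1 i)//= mxE !eqxx mul1r big1 ?addr0// => k ki.
  by rewrite mxE (negbTE ki) mul0r.
exists (exist _ (lker f) dimf).
exact: normal_coord_unique wi _.
Qed.

Lemma line_sub_hyperplane (W1 : grassmannian K 1 n.+1)
    (W2 : grassmannian K n n.+1) : (val W1 <= val W2)%VS =
  (\sum_k line_coord W1 k * normal_coord W2 k == 0).
Proof.
rewrite line_span -memvE mem_hyperplane; congr (_ == 0).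
by apply: eq_bigr => k _; rewrite mxE.
Qed.

Lemma schubert_cell_line (M : matroid 1 n.+1) W :
  schubert_cell M W <->
    forall k, line_coord W k != 0 = ([set k]%SET \in bases M).
Proof.
split=> [h k|h I]; first by apply/idP/idP => /(h (dsubset1 k)).
by have [k ->] := dsubset1P I; rewrite -/(line_coord W k) h.
Qed.

Lemma schubert_cell_hyperplane (M : matroid n n.+1) W :
  schubert_cell M W <->
    forall k, normal_coord W k != 0 = ([set~ k]%SET \in bases M).
Proof.
have nz k : (normal_coord W k != 0) = (plucker W (dsubsetC1 k) != 0).
  by rewrite /normal_coord mulf_eq0 signr_eq0.
split=> [h k|h I]; first by rewrite nz; apply/idP/idP => /(h (dsubsetC1 k)).
by have [k ->] := dsubsetC1P I; rewrite -nz h.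
Qed.

End LinesAndHyperplanes.

(** * Pluecker charts *)

Section BihomogeneousLift.
Variables (K : fieldType) (d1 d2 n : nat).
Local Notation N1 := #|{: dsubset d1 n}|.
Local Notation N2 := #|{: dsubset d2 n}|.

(** This is [bihomogeneous] with its degrees exposed, so that polynomials can be brought to a common
    bidegree before being added. *)
Definition bidegree (f : {mpoly K[N1 + N2]}) (a b : nat) : Prop :=
  forall m, m \in msupp f ->
    (\sum_(i < N1) m (lshift N2 i) = a)%N /\
    (\sum_(j < N2) m (rshift N1 j) = b)%N.

Lemma bidegree0 a b : bidegree 0 a b.
Proof. by move=> m; rewrite msupp0. Qed.

Lemma bidegree1 : bidegree 1 0 0.
Proof.
move=> m; rewrite msupp1 inE => /eqP ->.
by split; apply: big1 => i _; rewrite mnm0E.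
Qed.

Lemma bidegreeD f g a b : bidegree f a b -> bidegree g a b ->
  bidegree (f + g) a b.
Proof.
by move=> hf hg m /msuppD_le; rewrite mem_cat => /orP[/hf|/hg].
Qed.

Lemma bidegreeZ c f a b : bidegree f a b -> bidegree (c *: f) a b.
Proof. by move=> hf m /msuppZ_le/hf. Qed.

Lemma bidegreeM f g a b a' b' : bidegree f a b -> bidegree g a' b' ->
  bidegree (f * g) (a + a') (b + b').
Proof.
move=> hf hg m /msuppM_le/allpairsP[[m1 m2] /= [/hf[<- <-] /hg[<- <-] ->]].
by split; rewrite -big_split; apply: eq_bigr => i _; rewrite mnmDE.
Qed.

Lemma bidegreeX f a b e : bidegree f a b -> bidegree (f ^+ e) (e * a) (e * b).
Proof.
move=> hf; elim: e => [|e IH]; first by rewrite expr0; exact: bidegree1.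
by rewrite exprS !mulSn; exact: bidegreeM.
Qed.

Lemma bidegree_lshift i : bidegree 'X_(lshift N2 i) 1 0.
Proof.
move=> m; rewrite msuppX inE => /eqP ->; split.
  rewrite (bigD1 i)//= mnm1E eqxx big1// => j ji.
  by rewrite mnm1E eq_lshift eq_sym (negbTE ji).
by apply: big1 => j _; rewrite mnm1E eq_lrshift.
Qed.

Lemma bidegree_rshift i : bidegree 'X_(rshift N1 i) 0 1.
Proof.
move=> m; rewrite msuppX inE => /eqP ->; split.
  by apply: big1 => j _; rewrite mnm1E eq_rlshift.
rewrite (bigD1 i)//= mnm1E eqxx big1// => j ji.
by rewrite mnm1E eq_rshift eq_sym (negbTE ji).
Qed.

(** Each monomial picks up the same factor x^a y^b. Normalising the two blocks of coordinates
    separately therefore preserves vanishing. *)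
Lemma bidegree_scale f a b x y (z : 'I_(N1 + N2) -> K) : bidegree f a b ->
  f.@[fun k => (if split k is inl _ then x else y) * z k] =
  x ^+ a * y ^+ b * f.@[z].
Proof.
move=> hf; rewrite !mevalE mulr_sumr; apply: eq_big_seq => m /hf[<- <-].
rewrite mulrCA; congr (_ * _).
rewrite -!prodrXr !big_split_ord /= mulrACA -!big_split /=.
congr (_ * _); apply: eq_bigr => i _; rewrite exprMn.
  by case: split_ordP => j /eqP; rewrite ?eq_lshift ?eq_lrshift.
by case: split_ordP => j /eqP; rewrite ?eq_rshift ?eq_rlshift.
Qed.

Lemma closed_zero_locus (S : set {mpoly K[N1 + N2]}) :
  S `<=` @bihomogeneous K d1 d2 n -> closed (zero_locus S).
Proof.
move=> hS; rewrite -[zero_locus S]setCK; apply: open_closedC.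
by rewrite /open /= /zariski_open setCK; exists S.
Qed.

Lemma closed_zero_locusP (A : set (grass_prod K d1 d2 n)) : closed A ->
  exists2 S, S `<=` @bihomogeneous K d1 d2 n & A = zero_locus S.
Proof. by move=> /closed_openC [S hS AS]; exists S; rewrite // -AS setCK. Qed.

End BihomogeneousLift.

Section PluckerChart.
Variables (K : numFieldType) (R : realType) (n m : nat).
Local Notation X := (grass_prod K 1 n n.+1).
Local Notation N1 := #|{: dsubset 1 n.+1}|.
Local Notation N2 := #|{: dsubset n n.+1}|.
Variables (Y : set X) (psi : X -> 'I_m -> K) (g : {mpoly K[m]}) (t0 : 'I_m -> K).
(** V and U give the line and normal coordinates, normalised at i1 and i2, as polynomials on the
    chart; by [coordE] each chart variable is one of these. *)
Variables (i1 i2 : 'I_n.+1) (V U : 'I_n.+1 -> {mpoly K[m]}).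
Hypothesis g_psi : forall W, Y W -> g.@[psi W] != 0.
Hypothesis psi_onto : forall t, g.@[t] != 0 -> exists2 W, Y W & psi W =1 t.
Hypothesis g_t0 : g.@[t0] != 0.
Hypothesis line_neq0 : forall W, Y W -> line_coord W.1 i1 != 0.
Hypothesis normal_neq0 : forall W, Y W -> normal_coord W.2 i2 != 0.
Hypothesis lineE : forall W, Y W ->
  forall k, line_coord W.1 k = line_coord W.1 i1 * (V k).@[psi W].
Hypothesis normalE : forall W, Y W ->
  forall k, normal_coord W.2 k = normal_coord W.2 i2 * (U k).@[psi W].
Hypothesis coordE : forall j, (exists k, V k = 'X_j) \/ (exists k, U k = 'X_j).

Let xi k : {mpoly K[N1 + N2]} := 'X_(lshift N2 (enum_rank (dsubset1 k))).
Let eta (k : 'I_n.+1) : {mpoly K[N1 + N2]} :=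
  (-1) ^+ k *: 'X_(rshift N1 (enum_rank (dsubsetC1 k))).

Let xiE (W : X) k : (xi k).@[biplucker W] = line_coord W.1 k.
Proof. by rewrite mevalXU /biplucker (unsplitK (inl _)) enum_rankK. Qed.

Let etaE (W : X) k : (eta k).@[biplucker W] = normal_coord W.2 k.
Proof. by rewrite mevalZ mevalXU /biplucker (unsplitK (inr _)) enum_rankK. Qed.

Let xi_bidegree k : bidegree (xi k) 1 0.
Proof. exact: bidegree_lshift. Qed.

Let eta_bidegree k : bidegree (eta k) 0 1.
Proof. exact/bidegreeZ/bidegree_rshift. Qed.

(** F is a bihomogenisation of f, with the coordinates at i1 and i2, nonzero on Y, as homogenising
    variables. *)
Let lifts (f : {mpoly K[m]}) (F : {mpoly K[N1 + N2]}) a b :=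
  bidegree F a b /\ forall W, Y W -> F.@[biplucker W] =
    line_coord W.1 i1 ^+ a * normal_coord W.2 i2 ^+ b * f.@[psi W].

Let liftsM f f' F F' a b a' b' : lifts f F a b -> lifts f' F' a' b' ->
  lifts (f * f') (F * F') (a + a') (b + b').
Proof.
move=> [dF FE] [dF' FE']; split; first exact: bidegreeM.
by move=> W YW; rewrite !mevalM FE// FE'// !exprD; ring.
Qed.

Let lifts_raise f F a b a' b' : lifts f F a b ->
  lifts f (F * (xi i1 ^+ a' * eta i2 ^+ b')) (a + a') (b + b').
Proof.
move=> [dF FE]; split.
  apply: bidegreeM => //.
  have := bidegreeM (bidegreeX (e := a') (@xi_bidegree i1))
    (bidegreeX (e := b') (@eta_bidegree i2)).
  by rewrite !muln1 !muln0 addn0 add0n.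
by move=> W YW; rewrite !mevalM !rmorphXn /= FE// xiE etaE !exprD; ring.
Qed.

(** Each summand is first raised by the bidegree of the other, so that both reach the same
    bidegree. *)
Let liftsD f f' F F' a b a' b' : lifts f F a b -> lifts f' F' a' b' ->
  exists H c d, lifts (f + f') H c d.
Proof.
move=> /(@lifts_raise _ _ _ _ a' b') h /(@lifts_raise _ _ _ _ a b) h'.
rewrite ![(_ + a)%N]addnC ![(_ + b)%N]addnC in h'.
case: h h' => [dF FE] [dF' FE'].
eexists _, _, _; split; first exact: bidegreeD dF dF'.
by move=> W YW; rewrite !mevalD FE// FE'// mulrDr.
Qed.

Let lift_exists f : exists F a b, lifts f F a b.
Proof.
have lift1 : lifts 1 1 0 0.
  by split=> [|W YW]; [exact: bidegree1|rewrite !expr0 !meval1 !mul1r].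
have liftX j : exists F a b, lifts 'X_j F a b.
  case: (coordE j) => -[k kj].
    exists (xi k), 1%N, 0%N; split; first exact: xi_bidegree.
    by move=> W YW; rewrite xiE expr1 expr0 mulr1 -kj lineE.
  exists (eta k), 0%N, 1%N; split; first exact: eta_bidegree.
  by move=> W YW; rewrite etaE expr1 expr0 mul1r -kj normalE.
elim/mpolyind: f => [|c mm f _ _ [F [a [b hF]]]].
  exists 0, 0%N, 0%N; split=> [|W YW]; first exact: bidegree0.
  by rewrite !meval0 mulr0.
have [G [a' [b' [dG GE]]]] : exists F a b, lifts 'X_[mm] F a b.
  rewrite mpolyXE_id; elim/big_ind: _ => [|p q [P [? [? hP]]] [Q [? [? hQ]]]|j _].
  - by exists 1, 0%N, 0%N.
  - by eexists _, _, _; exact: liftsM hP hQ.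
  - have [P [? [? hP]]] := liftX j.
    elim: (mm j) => [|e [Q [? [? hQ]]]]; first by exists 1, 0%N, 0%N; rewrite expr0.
    by rewrite exprS; eexists _, _, _; exact: liftsM hP hQ.
have hG : lifts (c *: 'X_[mm]) (c *: G) a' b'.
  split=> [|W YW]; first exact: bidegreeZ.
  by rewrite !mevalZ GE// mulrCA.
exact: liftsD hG hF.
Qed.

Lemma krull_dim_plucker_chart : krull_dim R Y = m%:R%:E.
Proof.
apply: (krull_dim_affine_chart R g_psi psi_onto g_t0).
  move=> f; have [F [a [b [dF FE]]]] := lift_exists f.
  exists (zero_locus [set F]).
    by apply: closed_zero_locus => _ ->; exists a, b.
  move=> W YW; split=> [/(_ F erefl)|f0 _ ->]; rewrite FE//; last first.
    by rewrite f0 mulr0.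
  move=> /eqP; rewrite !mulf_eq0 !expf_eq0.
  by rewrite (negbTE (line_neq0 YW)) (negbTE (normal_neq0 YW)) !andbF => /eqP.
move=> A /closed_zero_locusP[S hS ->].
(* Dehomogenisation: up to one scalar per block, every Pluecker coordinate is a polynomial on the
   chart, namely some V l or signed U l. *)
have bipluckerE k : exists p : {mpoly K[m]}, forall W, Y W ->
    biplucker W k = (if split k is inl _ then line_coord W.1 i1
                     else normal_coord W.2 i2) * p.@[psi W].
  rewrite /biplucker; case: (split k) => i.
    have [l ->] := dsubset1P (enum_val i).
    by exists (V l) => W YW; rewrite -lineE.
  have [l ->] := dsubsetC1P (enum_val i).
  exists ((-1) ^+ l *: U l) => W YW; rewrite mevalZ mulrCA -normalE//.
  by rewrite /normal_coord mulrA -expr2 sqrr_sign mul1r.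
have [P PE] := choice bipluckerE.
exists [set f \mPo [tuple P i | i < N1 + N2] | f in S] => W YW.
have fE f : S f -> f.@[biplucker W] = 0 <->
    (f \mPo [tuple P i | i < N1 + N2]).@[psi W] = 0.
  move=> /hS[a [b hf]].
  rewrite (meval_eq _ (fun k => PE k W YW)).
  have -> : (f \mPo [tuple P i | i < N1 + N2]).@[psi W] =
      f.@[fun k => (P k).@[psi W]].
    by rewrite comp_mpoly_meval; apply: meval_eq => i; rewrite tnth_mktuple.
  rewrite (bidegree_scale _ _ _ hf).
  split=> [/eqP|->]; last by rewrite mulr0.
  rewrite !mulf_eq0 !expf_eq0.
  by rewrite (negbTE (line_neq0 YW)) (negbTE (normal_neq0 YW)) !andbF => /eqP.
split=> [h _ [f Sf <-]|h f Sf]; first by apply/fE => //; exact: h.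
by apply/fE => //; apply: h; exists f.
Qed.

End PluckerChart.

(** * Charts of tori *)

Section TorusChart.
Variables (K : numFieldType) (R : realType) (n : nat).
Local Notation ord := 'I_n.+1.
Variables (i1 i2 : ord) (A1 A2 : {set ord}).
Hypotheses (i1A1 : i1 \notin A1) (i2A2 : i2 \notin A2).

(* The coordinates are those of the line indexed by A1 and those of the normal
   vector indexed by A2, normalised to be 1 at i1 and i2 respectively. *)
Definition chart_set : {set ord + ord} := (inl @: A1 :|: inr @: A2)%SET.
Local Notation J := chart_set.

Lemma mem_chart_inl k : (inl k \in J) = (k \in A1).
Proof.
rewrite inE mem_imset; last by move=> ? ? [].
by rewrite orbC; case: imsetP => // -[].
Qed.

Lemma mem_chart_inr k : (inr k \in J) = (k \in A2).
Proof.
rewrite inE [X in _ || X]mem_imset; last by move=> ? ? [].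
by case: imsetP => // -[].
Qed.

Lemma card_chart_set : #|J| = (#|A1| + #|A2|)%N.
Proof.
rewrite cardsU !card_imset; [|by move=> ? ? []..].
rewrite (_ : _ :&: _ = finset.set0)%SET ?cards0 ?subn0//.
apply/setP => -[k|k]; rewrite !inE; apply/negbTE/negP => /andP[].
  by move=> _ /imsetP[].
by move=> /imsetP[].
Qed.

(** The sum form makes this total in s: it is the variable attached to s when s lies in J, and 0
    otherwise. *)
Definition chart_var (s : ord + ord) : {mpoly K[#|J|]} :=
  \sum_(j < #|J| | enum_val j == s) 'X_j.

Lemma chart_var_enum_val j : chart_var (enum_val j) = 'X_j.
Proof. by apply: big_pred1 => i; rewrite (inj_eq enum_val_inj). Qed.

Lemma chart_var_notin s : s \notin J -> chart_var s = 0.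
Proof.
by move=> sJ; apply: big_pred0 => j; apply: contraNF sJ => /eqP <-; exact: enum_valP.
Qed.

Lemma chart_var_eval (t : 'I_#|J| -> K) (u : ord + ord -> K) s :
  (forall j, t j = u (enum_val j)) ->
  (chart_var s).@[t] = if s \in J then u s else 0.
Proof.
move=> tu; case: ifPn => [sJ|/chart_var_notin ->]; last by rewrite meval0.
rewrite -{1}(enum_rankK_in sJ sJ) chart_var_enum_val mevalXU tu.
by rewrite enum_rankK_in.
Qed.

Lemma chart_var_neq0 (t : 'I_#|J| -> K) s :
  (forall j, t j != 0) -> ((chart_var s).@[t] != 0) = (s \in J).
Proof.
move=> t0; case: (boolP (s \in J)) => [sJ|/chart_var_notin ->]; last first.
  by rewrite meval0 eqxx.
by rewrite -(enum_rankK_in sJ sJ) chart_var_enum_val mevalXU t0.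
Qed.

(** c is added to the line coordinate at i2: it is 0 for the product of tori and the solved
    coordinate for the incidence locus. The two conditions keep it away from free and normalised
    coordinates. *)
Variable c : {mpoly K[#|J|]}.
Hypotheses (c_A1 : i2 \in A1 -> c = 0) (c_i1 : i1 = i2 -> c = 0).

Definition chart_line0 k : {mpoly K[#|J|]} := (k == i1)%:R + chart_var (inl k).
Definition chart_line k : {mpoly K[#|J|]} := chart_line0 k + (k == i2)%:R * c.
Definition chart_normal k : {mpoly K[#|J|]} := (k == i2)%:R + chart_var (inr k).

Lemma chart_line_i1 : chart_line i1 = 1.
Proof.
rewrite /chart_line /chart_line0 eqxx chart_var_notin ?mem_chart_inl// addr0.
by case: eqP => [/c_i1 ->|_]; rewrite ?mulr0 ?mul0r addr0.
Qed.

Lemma chart_line_A1 k : k \in A1 -> chart_line k = chart_var (inl k).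
Proof.
move=> kA1; rewrite /chart_line /chart_line0.
rewrite (_ : (k == i1) = false) ?add0r; last by apply: contraNF i1A1 => /eqP <-.
by case: eqP kA1 => [-> /c_A1 ->|_ _]; rewrite ?mulr0 ?mul0r addr0.
Qed.

Lemma chart_normal_i2 : chart_normal i2 = 1.
Proof.
by rewrite /chart_normal eqxx chart_var_notin ?mem_chart_inr// addr0.
Qed.

Lemma chart_normal_A2 k : k \in A2 -> chart_normal k = chart_var (inr k).
Proof.
move=> kA2; rewrite /chart_normal.
by rewrite (_ : (k == i2) = false) ?add0r//; apply: contraNF i2A2 => /eqP <-.
Qed.

Lemma chart_normal_notin k : k != i2 -> k \notin A2 -> chart_normal k = 0.
Proof.
move=> /negPf ki2 kA2.
by rewrite /chart_normal ki2 chart_var_notin ?mem_chart_inr// addr0.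
Qed.

Lemma chart_normal_neq0 (t : 'I_#|J| -> K) k : (forall j, t j != 0) ->
  ((chart_normal k).@[t] != 0) = (k == i2) || (k \in A2).
Proof.
move=> t0; have [->|ki2] := eqVneq k i2.
  by rewrite chart_normal_i2 meval1 oner_neq0.
have [kA2|kA2] := boolP (k \in A2).
  by rewrite chart_normal_A2// chart_var_neq0// mem_chart_inr kA2.
by rewrite chart_normal_notin// meval0 eqxx.
Qed.

Lemma chart_line0_neq0 (t : 'I_#|J| -> K) k : (forall j, t j != 0) ->
  ((chart_line0 k).@[t] != 0) = (k == i1) || (k \in A1).
Proof.
move=> t0; rewrite /chart_line0; have [->|ki1] := eqVneq k i1.
  by rewrite chart_var_notin ?mem_chart_inl// addr0 meval1 oner_neq0.
by rewrite add0r chart_var_neq0// mem_chart_inl.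
Qed.

Definition chart_ratio (W : grass_prod K 1 n n.+1) (s : ord + ord) : K :=
  match s with
  | inl k => line_coord W.1 k / line_coord W.1 i1
  | inr k => normal_coord W.2 k / normal_coord W.2 i2
  end.

Definition chart_coord W (j : 'I_#|J|) : K := chart_ratio W (enum_val j).

Lemma chart_varE W s :
  (chart_var s).@[chart_coord W] = if s \in J then chart_ratio W s else 0.
Proof. exact: chart_var_eval. Qed.

Variables (Y : set (grass_prod K 1 n n.+1)) (g : {mpoly K[#|J|]}).
Variable t0 : 'I_#|J| -> K.
Hypothesis g_t0 : g.@[t0] != 0.
Hypothesis g_chart : forall W, Y W -> g.@[chart_coord W] != 0.
Hypothesis line_neq0 : forall W, Y W -> line_coord W.1 i1 != 0.
Hypothesis normal_neq0 : forall W, Y W -> normal_coord W.2 i2 != 0.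
Hypothesis line_notin : forall W k, Y W -> k != i1 -> k \notin A1 ->
  line_coord W.1 k = line_coord W.1 i1 * ((k == i2)%:R * c).@[chart_coord W].
Hypothesis normal_notin : forall W k, Y W -> k != i2 -> k \notin A2 ->
  normal_coord W.2 k = 0.
Hypothesis chart_inY : forall (t : 'I_#|J| -> K) (W : grass_prod K 1 n n.+1) a b,
  g.@[t] != 0 -> a != 0 -> b != 0 ->
  (forall k, line_coord W.1 k = a * (chart_line k).@[t]) ->
  (forall k, normal_coord W.2 k = b * (chart_normal k).@[t]) -> Y W.

Lemma krull_dim_torus_chart : krull_dim R Y = #|J|%:R%:E.
Proof.
apply: (@krull_dim_plucker_chart K R n #|J| Y chart_coord g t0 i1 i2
  chart_line chart_normal) => //.
(* Surjectivity: the coordinate vectors read off from t define a line and a hyperplane, with scalars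
   a and b that cancel in the ratios. *)
- move=> t gt.
  have V1 : (chart_line i1).@[t] != 0 by rewrite chart_line_i1 meval1 oner_neq0.
  have U1 : (chart_normal i2).@[t] != 0 by rewrite chart_normal_i2 meval1 oner_neq0.
  have [W1 [a a0 W1E]] := @line_exists _ _ (fun k => (chart_line k).@[t]) i1 V1.
  have [W2 [b b0 W2E]] := @hyperplane_exists _ _ (fun k => (chart_normal k).@[t]) i2 U1.
  exists (W1, W2); first exact: (@chart_inY t (W1, W2) a b).
  move=> j; rewrite /chart_coord /chart_ratio /=.
  rewrite -[t j]mevalXU -chart_var_enum_val.
  have := enum_valP j; case: (enum_val j) => k.
    rewrite mem_chart_inl => kA; rewrite !W1E chart_line_i1 meval1 mulr1.
    by rewrite chart_line_A1// mulrAC mulfV// mul1r.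
  rewrite mem_chart_inr => kA; rewrite !W2E chart_normal_i2 meval1 mulr1.
  by rewrite chart_normal_A2// mulrAC mulfV// mul1r.
- move=> W YW k; have [->|ki1] := eqVneq k i1.
    by rewrite chart_line_i1 meval1 mulr1.
  have [kA|kA] := boolP (k \in A1).
    rewrite chart_line_A1// chart_varE mem_chart_inl kA /= mulrCA mulfV ?mulr1//.
    exact: line_neq0.
  rewrite line_notin// /chart_line /chart_line0 (negbTE ki1).
  by rewrite chart_var_notin ?mem_chart_inl// !add0r.
- move=> W YW k; have [->|ki2] := eqVneq k i2.
    by rewrite chart_normal_i2 meval1 mulr1.
  have [kA|kA] := boolP (k \in A2).
    rewrite chart_normal_A2// chart_varE mem_chart_inr kA /= mulrCA mulfV ?mulr1//.
    exact: normal_neq0.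
  by rewrite normal_notin// chart_normal_notin// meval0 mulr0.
- move=> j; have := enum_valP j; case Ej : (enum_val j) => [k|k].
    rewrite mem_chart_inl => kA; left; exists k.
    by rewrite chart_line_A1// -Ej chart_var_enum_val.
  rewrite mem_chart_inr => kA; right; exists k.
  by rewrite chart_normal_A2// -Ej chart_var_enum_val.
Qed.

End TorusChart.

(** * The product of tori and its incidence locus *)

Section Tori.
Variables (K : numFieldType) (R : realType) (n : nat) (K1 K2 : {set 'I_n.+1}).

Definition torus_prod : set (grass_prod K 1 n n.+1) :=
  [set W | (forall k, (line_coord W.1 k != 0) = (k \in K1)) /\
           (forall k, (normal_coord W.2 k != 0) = (k \in K2))].

Definition torus_incidence : set (grass_prod K 1 n n.+1) :=
  torus_prod `&` [set W | \sum_k line_coord W.1 k * normal_coord W.2 k = 0].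

Lemma prod_mpolyX_neq0 m (t : 'I_m -> K) :
  reflect (forall j, t j != 0) ((\prod_j 'X_j : {mpoly K[m]}).@[t] != 0).
Proof.
rewrite rmorph_prod /=; apply: (iffP (prodf_neq0 _ _)) => h j.
  by have := h j isT; rewrite mevalXU.
by move=> _; rewrite mevalXU.
Qed.

Lemma torus_line_eq0 W k : torus_prod W -> k \notin K1 -> line_coord W.1 k = 0.
Proof. by move=> [WE _]; rewrite -WE negbK => /eqP. Qed.

Lemma torus_normal_eq0 W k : torus_prod W -> k \notin K2 -> normal_coord W.2 k = 0.
Proof. by move=> [_ WE]; rewrite -WE negbK => /eqP. Qed.

Lemma setD1_neq (T : finType) (A : {set T}) x y :
  y != x -> (y \in A :\ x)%SET = (y \in A).
Proof. by move=> yx; rewrite !inE yx. Qed.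

Lemma setD1_or (T : finType) (A : {set T}) x y :
  x \in A -> (y == x) || (y \in A :\ x)%SET = (y \in A).
Proof. by move=> xA; rewrite !inE; case: eqVneq => // ->. Qed.

Lemma chart_coord_neq0 (i1 i2 : 'I_n.+1) (A1 A2 : {set 'I_n.+1}) W j :
  torus_prod W -> i1 \in K1 -> i2 \in K2 -> A1 \subset K1 -> A2 \subset K2 ->
  @chart_coord K n i1 i2 A1 A2 W j != 0.
Proof.
move=> [W1 W2] i1K i2K /fintype.subsetP A1K /fintype.subsetP A2K; rewrite /chart_coord.
have := enum_valP j; case: (enum_val j) => k /=.
  by rewrite mem_chart_inl => /A1K kK; rewrite mulf_neq0 ?invr_eq0// W1.
by rewrite mem_chart_inr => /A2K kK; rewrite mulf_neq0 ?invr_eq0// W2.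
Qed.

Lemma krull_dim_torus_prod i1 i2 : i1 \in K1 -> i2 \in K2 ->
  krull_dim R torus_prod = (#|(K1 :\ i1)%SET| + #|(K2 :\ i2)%SET|)%N%:R%:E.
Proof.
move=> i1K i2K.
have i1A : i1 \notin (K1 :\ i1)%SET by rewrite !inE eqxx.
have i2A : i2 \notin (K2 :\ i2)%SET by rewrite !inE eqxx.
rewrite -card_chart_set.
(* The chart is the full torus where all variables are nonzero; it contains the all-ones point. *)
apply: (@krull_dim_torus_chart K R n i1 i2 (K1 :\ i1)%SET (K2 :\ i2)%SET i1A i2A
  0 _ _ torus_prod (\prod_j 'X_j) (fun=> 1)) => //.
- by apply/prod_mpolyX_neq0 => j; rewrite oner_neq0.
- move=> W YW; apply/prod_mpolyX_neq0 => j.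
  by rewrite chart_coord_neq0// subsetDl.
- by move=> W [-> _].
- by move=> W [_ ->].
- move=> W k YW ki1; rewrite setD1_neq// mulr0 meval0 mulr0.
  exact: torus_line_eq0.
- by move=> W k YW ki2; rewrite setD1_neq//; exact: torus_normal_eq0.
move=> t W a b /prod_mpolyX_neq0 t0 a0 b0 WE1 WE2; split=> k.
  rewrite WE1 mulf_eq0 (negbTE a0) /= /chart_line mulr0 addr0.
  by rewrite chart_line0_neq0// setD1_or.
by rewrite WE2 mulf_eq0 (negbTE b0) /= chart_normal_neq0// setD1_or.
Qed.

Lemma krull_dim_torus_incidence i1 i2 : i1 != i2 ->
  i1 \in K1 :&: K2 -> i2 \in K1 :&: K2 ->
  krull_dim R torus_incidence = (#|(K1 :\ i1 :\ i2)%SET| + #|(K2 :\ i2)%SET|)%N%:R%:E.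
Proof.
move=> i12; rewrite !inE => /andP[i1K1 i1K2] /andP[i2K1 i2K2].
set A1 := (K1 :\ i1 :\ i2)%SET; set A2 := (K2 :\ i2)%SET.
have i1A : i1 \notin A1 by rewrite !inE eqxx andbF.
have i2A : i2 \notin A2 by rewrite !inE eqxx.
have i2A1 : i2 \notin A1 by rewrite !inE eqxx.
have A1K1 : A1 \subset K1
  by apply/fintype.subsetP => x; rewrite !inE => /and3P[].
pose V0 := chart_line0 K i1 A1 A2; pose U := chart_normal K i2 A1 A2.
(* Solving the incidence relation for the i2-th coordinate of the line. *)
pose c := - \sum_k V0 k * U k.
(* The sum defining c thus has no term at i2, where the coordinate being solved for would occur. *)
have V0i2 : V0 i2 = 0.
  rewrite /V0 /chart_line0 eq_sym (negbTE i12) add0r chart_var_notin//.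
  by rewrite mem_chart_inl.
have U_i2 : U i2 = 1 by exact: chart_normal_i2.
have c_coord W : torus_incidence W ->
    line_coord W.1 i2 = line_coord W.1 i1 * c.@[chart_coord i1 i2 W].
  move=> [YW /= W0]; have [W1 W2] := YW.
  have l1 : line_coord W.1 i1 != 0 by rewrite W1.
  have n2 : normal_coord W.2 i2 != 0 by rewrite W2.
  have V0E k : k != i2 ->
      line_coord W.1 i1 * (V0 k).@[chart_coord i1 i2 W] = line_coord W.1 k.
    move=> ki2; rewrite /V0 /chart_line0 mevalD chart_varE mem_chart_inl.
    have [->|ki1] := eqVneq k i1.
      by rewrite meval1 (negbTE i1A) addr0 mulr1.
    rewrite meval0 add0r; case: ifPn => [_|]; first by rewrite /= mulrCA mulfV ?mulr1.
    by rewrite setD1_neq// setD1_neq// => kK1; rewrite mulr0 (torus_line_eq0 YW).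
  have UE k : normal_coord W.2 i2 * (U k).@[chart_coord i1 i2 W] = normal_coord W.2 k.
    rewrite /U /chart_normal mevalD chart_varE mem_chart_inr.
    have [->|ki2] := eqVneq k i2.
      by rewrite meval1 (negbTE i2A) addr0 mulr1.
    rewrite meval0 add0r; case: ifPn => [_|]; first by rewrite /= mulrCA mulfV ?mulr1.
    by rewrite setD1_neq// => kK2; rewrite mulr0 (torus_normal_eq0 YW).
  (* After multiplication by the normal coordinate at i2, the claim is the incidence relation with
     its i2 term isolated. *)
  apply: (mulIf n2); rewrite mulrAC mevalN mulrN rmorph_sum /= mulr_sumr.
  move/eqP: W0; rewrite (bigD1 i2)//= addr_eq0 => /eqP ->.
  rewrite [in RHS](bigD1 i2)//= V0i2 mul0r meval0 mulr0 add0r.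
  congr (- _); apply: eq_bigr => k ki2.
  by rewrite mevalM mulrACA V0E// UE.
rewrite -card_chart_set.
(* The factor c in the open condition keeps the eliminated coordinate nonzero, as i2 in K1
   demands. *)
apply: (@krull_dim_torus_chart K R n i1 i2 A1 A2 i1A i2A
  c _ _ torus_incidence (\prod_j 'X_j * c) (fun=> 1)) => //.
- by rewrite (negbTE i2A1).
- by move=> e; rewrite e eqxx in i12.
- rewrite mevalM mulf_neq0//.
    by apply/prod_mpolyX_neq0 => j; rewrite oner_neq0.
  (* At the all-ones point -c is a sum of nonnegative terms, and its term at i1 is nonzero because
     i1 also lies in K2; hence the chart is nonempty. *)
  rewrite mevalN oppr_eq0 rmorph_sum /=; apply/negP => /eqP.
  have var_ge0 s : 0 <= (chart_var K A1 A2 s).@[fun=> 1].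
    by rewrite (@chart_var_eval _ _ _ _ _ (fun=> 1))//; case: ifP.
  have nat_ge0 (b : bool) : 0 <= (b%:R : {mpoly K[#|chart_set A1 A2|]}).@[fun=> 1].
    by case: b; rewrite ?meval1 ?meval0.
  have t1 (j : 'I_#|chart_set A1 A2|) : (1 : K) != 0 by rewrite oner_neq0.
  have term_ge0 k (_ : true) : 0 <= (V0 k * U k).@[fun=> 1].
    by rewrite mevalM mulr_ge0// mevalD addr_ge0.
  move=> /(psumr_eq0P term_ge0)/(_ i1 isT)/eqP; apply/negP.
  rewrite mevalM mulf_eq0 negb_or chart_line0_neq0// chart_normal_neq0//.
  by rewrite eqxx (negbTE i12) orTb setD1_neq.
- move=> W YW'; have [YW _] := YW'; rewrite mevalM mulf_neq0//.
    apply/prod_mpolyX_neq0 => j.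
    by rewrite chart_coord_neq0// subsetDl.
  have : line_coord W.1 i2 != 0 by rewrite YW.1.
  by apply: contraNneq => cW; rewrite (c_coord W)// cW mulr0.
- by move=> W [[-> _] _].
- by move=> W [[_ ->] _].
- move=> W k YW; have [->|ki2] := eqVneq k i2 => ki1 kA1.
    by rewrite mul1r; exact: c_coord.
  rewrite mul0r meval0 mulr0; apply: (torus_line_eq0 YW.1).
  by move: kA1; rewrite setD1_neq// setD1_neq.
- by move=> W k [YW _] ki2; rewrite setD1_neq//; exact: torus_normal_eq0.
move=> t W a b; rewrite mevalM mulf_eq0 negb_or => /andP[/prod_mpolyX_neq0 t0 ct].
move=> a0 b0 WE1 WE2; split; first split=> k.
- rewrite WE1 mulf_eq0 (negbTE a0) /= /chart_line -/(V0 k).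
  have [->|ki2] := eqVneq k i2.
    by rewrite V0i2 add0r mul1r ct i2K1.
  by rewrite mul0r addr0 chart_line0_neq0// setD1_neq// setD1_or.
- by rewrite WE2 mulf_eq0 (negbTE b0) /= chart_normal_neq0// setD1_or.
(* The incidence sum is a b times the value of \sum_k V0 k * U k + c, which is 0 by the choice of
   c. *)
rewrite /= (eq_bigr (fun k => a * b * (chart_line i1 i2 c k * U k).@[t])).
  rewrite -mulr_sumr -rmorph_sum /=.
  rewrite (eq_bigr (fun k => V0 k * U k + (k == i2)%:R * c * U k)); last first.
    by move=> k _; rewrite /chart_line mulrDl.
  rewrite big_split /= [X in _ + X](bigD1 i2)//= eqxx mul1r U_i2 mulr1.
  rewrite [X in c + X]big1 ?addr0; last by move=> k /negPf ->; rewrite !mul0r.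
  by rewrite /c subrr meval0 mulr0.
by move=> k _; rewrite WE1 WE2 mevalM mulrACA.
Qed.

End Tori.

(** * From plurimatroids to tori *)

Lemma matroid1_nonempty n (M : matroid 1 n.+1) : exists k, [set k]%SET \in bases M.
Proof.
have /set0Pn[I IM] := bases_neq0 M.
by have /eqP/cards1P[k Ik] := bases_card IM; exists k; rewrite -Ik.
Qed.

Lemma matroidC1_nonempty n (M : matroid n n.+1) : exists k, [set~ k]%SET \in bases M.
Proof.
have /set0Pn[I IM] := bases_neq0 M.
have cI : #|I| == n by rewrite (bases_card IM).
have [k /(congr1 val) /= Ik] := dsubsetC1P (exist _ I cI).
by exists k; rewrite -Ik.
Qed.

Lemma schubert_cell_prod_torus (K : fieldType) n (M : plurimatroid 1 n n.+1) :
  @schubert_cell_prod K 1 n n.+1 M =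
    [set W | (forall k, (line_coord W.1 k != 0) = ([set k]%SET \in bases M.1)) /\
             (forall k, (normal_coord W.2 k != 0) = ([set~ k]%SET \in bases M.2))].
Proof.
apply/seteqP; split=> W [].
  by move=> /schubert_cell_line h1 /schubert_cell_hyperplane h2.
by move=> h1 h2; split; [apply/schubert_cell_line|apply/schubert_cell_hyperplane].
Qed.

Theorem corollary5p7 (R : realType) (n : nat) (hn : (3 <= n)%N)
    (M : plurimatroid 1 n.-1 n) :
  let K1 : {set 'I_n} := [set k | [set k] \in bases M.1]%SET in
  let K2 : {set 'I_n} := [set k | [set~ k] \in bases M.2]%SET in
  let FM : set (grass_prod R[i] 1 n.-1 n) := thin_schubert_cell M in
  let GM : set (grass_prod R[i] 1 n.-1 n) := schubert_cell_prod M in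
  (#|K1 :&: K2| = 0%N ->
     krull_dim R FM = krull_dim R GM /\
     krull_dim R GM = (#|K1|%:R + #|K2|%:R - 2)%:E) /\
  ((2 <= #|K1 :&: K2|)%N ->
     krull_dim R FM = (krull_dim R GM - 1)%E /\
     (krull_dim R GM - 1)%E = (#|K1|%:R + #|K2|%:R - 3)%:E).
Proof.
case: n hn M => // n _ M /=.
set K1 := [set k | _]%SET; set K2 := [set k | _]%SET.
set FM := thin_schubert_cell M; set GM := schubert_cell_prod M.
have GME : GM = @torus_prod _ n K1 K2.
  rewrite /GM schubert_cell_prod_torus; apply/seteqP.
  by split=> W [h1 h2]; split=> k; rewrite ?h1 ?h2 !inE.
have FME : FM = @torus_incidence _ n K1 K2.
  rewrite /FM /thin_schubert_cell -/GM GME; congr (_ `&` _).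
  by apply/seteqP; split=> W; rewrite /flag_variety /= line_sub_hyperplane => /eqP.
have [k1 k1K] : exists k, k \in K1.
  by have [k kM] := matroid1_nonempty M.1; exists k; rewrite inE.
have [k2 k2K] : exists k, k \in K2.
  by have [k kM] := matroidC1_nonempty M.2; exists k; rewrite inE.
have dimG : krull_dim R GM = (#|K1|%:R + #|K2|%:R - 2)%:E.
  rewrite GME (krull_dim_torus_prod _ _ k1K k2K); congr (_%:E).
  by rewrite (cardsD1 k1 K1) (cardsD1 k2 K2) k1K k2K !natrD /=; ring.
split=> [/eqP|K12].
  rewrite cards_eq0 => /eqP K0; split; last exact: dimG.
  congr (krull_dim R _); rewrite FME GME; apply/seteqP; split=> W; first by case.
  move=> YW; split=> //=; apply: big1 => k _.
  have : k \notin (K1 :&: K2)%SET by rewrite K0 inE.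
  rewrite finset.in_setI negb_and => /orP[kK1|kK2].
    by rewrite (torus_line_eq0 YW kK1) mul0r.
  by rewrite (torus_normal_eq0 YW kK2) mulr0.
have dimG1 : (krull_dim R GM - 1)%E = (#|K1|%:R + #|K2|%:R - 3)%:E.
  by rewrite dimG -EFinB; congr (_%:E); ring.
split; last exact: dimG1.
have [i1 [i2 [i1K i2K i12]]] := card_gt1P K12.
rewrite dimG1 FME (krull_dim_torus_incidence _ _ i12 i1K i2K); congr (_%:E).
move: i1K i2K; rewrite !finset.in_setI => /andP[i1K1 _] /andP[i2K1 i2K2].
(* K1 loses i1 to normalisation and i2 to elimination, K2 loses only i2; together these account for
   the 3. *)
rewrite (cardsD1 i1 K1) (cardsD1 i2 (K1 :\ i1)) (cardsD1 i2 K2) i1K1 i2K2.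
by rewrite (setD1_neq K1 (x := i1)) 1?eq_sym// i2K1 !natrD /=; ring.
Qed.
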